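(* Let $a_1,a_2,a_3,b_1,b_2,b_3\in\mathbb{R}$ and suppose that $$J=\begin{bmatrix} a_1 & b_1 & 0 \\ 0 & a_2 & b_2 \\ b_3 & 0 & a_3 \end{bmatrix}$$ is the Jacobian at a Hopf bifurcation point, i.e. its eigenvalues are one real number and a pair $\pm\mathrm{i}\omega$ with $\omega\in\mathbb{R}$, $\omega>0$. Then the eigenvalues of $J$ are the real eigenvalue $\tau=a_1+a_2+a_3$ and the imaginary pair $\pm\mathrm{i}\omega$, where $$\omega=\sqrt{a_1a_2+a_1a_3+a_2a_3}$$ (positive square root). Moreover: (1) The real eigenvalue $\tau$ has eigenvector $\left[1,\ \frac{\tau-a_1}{b_1},\ \frac{\tau-a_1}{b_1}\,\frac{\tau-a_2}{b_2}\right]^{\mathrm T}$. (2) The imaginary eigenvalue $\mathrm{i}\omega$ has eigenvector $\left[1,\ \frac{\mathrm{i}\omega-a_1}{b_1},\ \frac{\mathrm{i}\omega-a_1}{b_1}\,\frac{\mathrm{i}\omega-a_2}{b_2}\right]^{\mathrm T}$. (3) The imaginary eigenvalue $-\mathrm{i}\omega$ has the complex conjugate eigenvector $\left[1,\ \frac{-\mathrm{i}\omega-a_1}{b_1},\ \frac{-\mathrm{i}\omega-a_1}{b_1}\,\frac{-\mathrm{i}\omega-a_2}{b_2}\right]^{\mathrm T}$.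
   Context: $J$ is the general Jacobian of an ODE $\dot x_1=f_1(x_1,x_2)$, $\dot x_2=f_2(x_2,x_3)$, $\dot x_3=f_3(x_3,x_1)$ with $x_j\in\mathbb{R}$ (the 3-node fully inhomogeneous unidirectional ring). Under the stated hypothesis every $b_j$ is nonzero, so the quotients are well defined. *)

(* Defs.v *)
From mathcomp Require Import all_boot all_order all_algebra.
From mathcomp Require Import reals complex.

Set Implicit Arguments.
Unset Strict Implicit.
Unset Printing Implicit Defensive.

Import Order.TTheory GRing.Theory Num.Theory.

Local Open Scope ring_scope.
Local Open Scope complex_scope.

Definition ring_jacobian (F : fieldType) (a1 a2 a3 b1 b2 b3 : F) : 'M[F]_3 :=
  \matrix_(i < 3, j < 3)
    nth 0 (nth [::] [:: [:: a1;  b1;  0 ];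
                        [:: 0 ;  a2;  b2];
                        [:: b3;  0 ;  a3] ] i) j.

Definition ring_eigenvector (F : fieldType) (a1 a2 b1 b2 z : F) : 'cV[F]_3 :=
  \col_(i < 3)
    nth 0 [:: 1; (z - a1) / b1; (z - a1) / b1 * ((z - a2) / b2)] i.

(* Column eigenvectors: the library's [eigenspace] consists of row vectors. *)
Definition is_eigenvector (F : fieldType) (n : nat)
    (A : 'M[F]_n) (z : F) (v : 'cV[F]_n) : Prop :=
  v != 0 /\ A *m v = z *: v.

(* For w > 0 the numbers t, i w and - i w are distinct, so each of them is a
   simple eigenvalue and multiplicities need not be recorded.
   [eigenvalue] refers to row eigenvectors; a square matrix has the same
   eigenvalues for row and for column eigenvectors. *)
Definition has_spectrum (R : realType) (A : 'M[R]_3) (t w : R) : Prop :=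
  forall z : R[i],
    eigenvalue (map_mx (real_complex R) A) z
    <-> [\/ z = t%:C, z = w*i | z = - w*i].

Definition is_hopf_jacobian (R : realType) (A : 'M[R]_3) : Prop :=
  exists t w : R, 0 < w /\ has_spectrum A t w.

(* Main.v *)
(** The eigenvalues of [J] are the roots of
    [(z - a1) (z - a2) (z - a3) - b1 b2 b3].  If the product [b1 b2 b3]
    vanished all of them would be real, so no [bj] is zero.  Separating real and
    imaginary parts at the root [i w] gives [w^2 = e2] and [b1 b2 b3 = e1 e2 - e3]
    with [ek] the elementary symmetric functions of the [aj], whence the
    characteristic polynomial factors as [(z - e1) (z^2 + e2)].  The eigenvector
    equation is solved by substitution row by row; the last row is the
    characteristic equation. *)
Require Import Defs.
From mathcomp Require Import all_boot all_order all_algebra.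
From mathcomp Require Import reals complex.
From mathcomp Require Import ring lra.

Import Order.TTheory GRing.Theory Num.Theory.

Local Open Scope ring_scope.
Local Open Scope complex_scope.

Lemma map_ring_jacobian (F K : fieldType) (f : {rmorphism F -> K})
    (a1 a2 a3 b1 b2 b3 : F) :
  map_mx f (ring_jacobian a1 a2 a3 b1 b2 b3) =
  ring_jacobian (f a1) (f a2) (f a3) (f b1) (f b2) (f b3).
Proof.
apply/matrixP => i j; rewrite !mxE.
by case: i => [[|[|[|//]]] ?]; case: j => [[|[|[|//]]] ?] //=; rewrite rmorph0.
Qed.

(** Taken at complex conjugation, this relates the eigenvectors of the two imaginary eigenvalues. *)
Lemma map_ring_eigenvector (F K : fieldType) (f : {rmorphism F -> K})
    (a1 a2 b1 b2 z : F) :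
  map_mx f (ring_eigenvector a1 a2 b1 b2 z) =
  ring_eigenvector (f a1) (f a2) (f b1) (f b2) (f z).
Proof.
apply/matrixP => i j; rewrite !mxE.
by case: i => [[|[|[|//]]] ?] /=; rewrite ?rmorph1 ?rmorphM ?fmorphV ?rmorphB.
Qed.

(** Only the identity and one 3-cycle contribute to the determinant of [z - J]; the 3-cycle is even
    and picks the entries [- b1], [- b2], [- b3]. *)
Lemma eigenvalue_ring_jacobian (F : fieldType) (a1 a2 a3 b1 b2 b3 z : F) :
  eigenvalue (ring_jacobian a1 a2 a3 b1 b2 b3) z =
  ((z - a1) * (z - a2) * (z - a3) == b1 * b2 * b3).
Proof.
(* Evaluation at [z] is moved inside the determinant, so that the expansion takes place over [F]
   instead of over polynomials. *)
rewrite eigenvalue_root_char /root /char_poly -horner_evalE -det_map_mx.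
rewrite (expand_det_row _ ord0) !big_ord_recl big_ord0 /cofactor.
rewrite !(expand_det_row _ ord0) !big_ord_recl !big_ord0 /cofactor !det_mx11.
rewrite !mxE /= /bump /= !horner_evalE !hornerE /=.
rewrite -[RHS]subr_eq0; congr (_ == _); ring.
Qed.

Lemma ring_eigenvectorP (F : fieldType) (a1 a2 a3 b1 b2 b3 z : F) :
  b1 != 0 -> b2 != 0 ->
  (z - a1) * (z - a2) * (z - a3) = b1 * b2 * b3 ->
  is_eigenvector (ring_jacobian a1 a2 a3 b1 b2 b3) z
    (ring_eigenvector a1 a2 b1 b2 z).
Proof.
move=> b1n0 b2n0 zE; split.
  apply/eqP => /matrixP/(_ ord0 ord0); rewrite !mxE /=.
  by apply/eqP; exact: oner_neq0.
apply/matrixP => i j; rewrite !mxE !big_ord_recl big_ord0 !mxE /=.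
case: i => [[|[|[|//]]] ?] /=; try by field; rewrite ?b1n0 ?b2n0.
(* Only the last row is left; solving the characteristic equation for [b3] turns it into an identity
   of fractions. *)
have -> : b3 = (z - a1) * (z - a2) * (z - a3) / (b1 * b2).
  by rewrite zE; field; rewrite b1n0 b2n0.
by field; rewrite b1n0 b2n0.
Qed.

Lemma ring_jacobian_imaginary_root (R : realType) (a1 a2 a3 c w : R) :
  0 < w ->
  (w*i - a1%:C) * (w*i - a2%:C) * (w*i - a3%:C) = c%:C ->
  w ^+ 2 = a1 * a2 + a1 * a3 + a2 * a3 /\
  c = (a1 + a2 + a3) * (a1 * a2 + a1 * a3 + a2 * a3) - a1 * a2 * a3.
Proof.
move=> w0 /eqP; rewrite eq_complex /= => /andP[/eqP re /eqP im].
have w2 : w ^+ 2 = a1 * a2 + a1 * a3 + a2 * a3.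
  (* The imaginary part reads [w * (a1 * a2 + a1 * a3 + a2 * a3 - w ^+ 2) = 0]. *)
  by apply: (mulfI (lt0r_neq0 w0)); lra.
by split=> //; rewrite -w2; lra.
Qed.

Theorem theorem3p4 (R : realType) (a1 a2 a3 b1 b2 b3 : R) :
  let J := ring_jacobian a1 a2 a3 b1 b2 b3 in
  let JC := map_mx (real_complex R) J in
  let tau := a1 + a2 + a3 in
  let omega := Num.sqrt (a1 * a2 + a1 * a3 + a2 * a3) in
  let iomega : R[i] := omega*i in
  let v (z : R[i]) := ring_eigenvector a1%:C a2%:C b1%:C b2%:C z in
  is_hopf_jacobian J ->
  [/\ b1 != 0, b2 != 0 & b3 != 0] /\
  (0 < omega /\ has_spectrum J tau omega) /\
  is_eigenvector J tau (ring_eigenvector a1 a2 b1 b2 tau) /\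
  is_eigenvector JC iomega (v iomega) /\
  (is_eigenvector JC (- iomega) (v (- iomega)) /\
   v (- iomega) = map_mx conjc (v iomega)).
Proof.
move=> J JC tau omega iomega v [t [w [w0 specJ]]].
have eigJC z : eigenvalue JC z =
    ((z - a1%:C) * (z - a2%:C) * (z - a3%:C) == (b1 * b2 * b3)%:C).
  by rewrite /JC map_ring_jacobian eigenvalue_ring_jacobian !rmorphM.
have rootw : (w*i - a1%:C) * (w*i - a2%:C) * (w*i - a3%:C) = (b1 * b2 * b3)%:C.
  by apply/eqP; rewrite -eigJC; apply/specJ; apply: Or32.
have [w2 bE] := ring_jacobian_imaginary_root _ _ _ _ _ _ w0 rootw.
have omegaE : omega = w by rewrite /omega -w2 sqrtr_sqr gtr0_norm.
have b_neq0 : b1 * b2 * b3 != 0.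
  apply/negP => /eqP b0; move: rootw; rewrite b0 => /eqP.
  (* Otherwise [w*i] would equal one of the real numbers [a1], [a2], [a3], against [0 < w]. *)
  by rewrite !mulf_eq0 !subr_eq0 !eq_complex /= (gt_eqF w0) !andbF.
have [b1n0 b2n0 b3n0] : [/\ b1 != 0, b2 != 0 & b3 != 0].
  by move: b_neq0; rewrite !mulf_eq0 !negb_or => /andP[/andP[]].
have iw2 : (w*i : R[i]) ^+ 2 = - (a1 * a2 + a1 * a3 + a2 * a3)%:C.
  by rewrite -w2; apply/eqP; rewrite eq_complex /=;
    apply/andP; split; apply/eqP; ring.
have spec : has_spectrum J tau omega.
  move=> z; rewrite -/JC eigJC omegaE.
  have -> : ((z - a1%:C) * (z - a2%:C) * (z - a3%:C) == (b1 * b2 * b3)%:C) =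
      ((z - tau%:C) * ((z - w*i) * (z + w*i)) == 0).
    (* Forming [z ^+ 2 - (w*i) ^+ 2] eliminates the imaginary unit, leaving a polynomial identity in
       [z] and the [aj]. *)
    rewrite -subr_sqr iw2 bE /tau -subr_eq0; congr (_ == _).
    by rewrite !(rmorphD, rmorphB, rmorphM, rmorphN) /=; ring.
  rewrite !mulf_eq0 !subr_eq0 addr_eq0.
  split; first by case/or3P => /eqP ->; [apply: Or31|apply: Or32|apply: Or33].
  by case=> ->; rewrite eqxx ?orbT.
have eigv z : eigenvalue JC z -> is_eigenvector JC z (v z).
  rewrite eigJC /JC map_ring_jacobian => /eqP zE.
  by apply: ring_eigenvectorP; rewrite ?fmorph_eq0 // zE !rmorphM.
split=> //; split; first by split=> //; rewrite omegaE.
split; first by apply: ring_eigenvectorP => //; rewrite bE /tau; ring.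
split; first by apply/eigv/spec; apply: Or32.
have iomegaN : - iomega = (- omega)*i.
  by apply/eqP; rewrite eq_complex /= oppr0 !eqxx.
split; first by apply/eigv/spec; apply: Or33.
(* Conjugation fixes the real parameters and sends [omega*i] to [(- omega)*i]. *)
by rewrite /v map_ring_eigenvector iomegaN /= oppr0.
Qed.
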